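(* For every $n\ge 0$, $$\sum_{\sigma\in\mathfrak S_n} s^{\mathrm{lec}\,\sigma}\,q^{\mathrm{inv}\,\sigma}\,Y^{\mathrm{pix}\,\sigma}=A_n(s,1,q,Y),$$ where the polynomials $A_n(s,1,q,Y)$ are defined by $$\sum_{n\ge0}A_n(s,1,q,Y)\frac{u^n}{(q;q)_n}=\frac{(1-sq)\,e_q(Yu)}{e_q(squ)-sq\,e_q(u)}.$$
   Context: $(q;q)_0=1$, $(q;q)_n=(1-q)\cdots(1-q^n)$, and $e_q(u)=\sum_{n\ge0}u^n/(q;q)_n$. $\mathrm{inv}$ of a word (or permutation) is its number of pairs of positions $a<b$ whose letters satisfy $x_a>x_b$. A hook is a word $x_1\cdots x_m$ of distinct positive integers with $m\ge 2$, $x_1>x_2$, and either $m=2$ or $x_2<\cdots<x_m$. Each $\sigma\in\mathfrak S_n$ has a unique hook factorization $p\,\tau_1\cdots\tau_k$ with $p$ increasing (possibly empty) and each $\tau_i$ a hook; $\mathrm{pix}\,\sigma$ is the length of $p$ and $\mathrm{lec}\,\sigma=\sum_i\mathrm{inv}\,\tau_i$. *)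

(* Defs.v *)
From HB Require Import structures.
From mathcomp Require Import all_boot all_order all_fingroup all_algebra.
From mathcomp.multinomials Require Import mpoly.

Set Implicit Arguments.
Unset Strict Implicit.
Unset Printing Implicit Defensive.

Import GRing.Theory.

Definition word_inv (w : seq nat) : nat :=
  #|[set ab : 'I_(size w) * 'I_(size w) |
      (ab.1 < ab.2) && (nth 0 w ab.1 > nth 0 w ab.2)]|.

(* The word x_1 ... x_m is the sequence x, with x_i = nth 0 x i.-1. *)
Definition is_hook (x : seq nat) : bool :=
  [&& uniq x, all (ltn 0) x, 2 <= size x, nth 0 x 0 > nth 0 x 1
    & (size x == 2) || sorted ltn (behead x)].

(* A factorization p tau_1 ... tau_k is the pair (p, [:: tau_1; ...; tau_k]). *)
Definition is_hook_factorization (w : seq nat) (f : seq nat * seq (seq nat)) :=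
  [&& sorted ltn f.1, all is_hook f.2 & f.1 ++ flatten f.2 == w].

Lemma ex_hook_factorization (w : seq nat) :
  uniq w -> all (ltn 0) w -> exists f, is_hook_factorization w f.
Proof.
elim: w => [|x w IH]; first by move=> _ _; exists ([::], [::]).
move=> /= /andP[xw uw] /andP[x0 w0].
have [[p ts] /and3P[/= sp hts /eqP E]] := IH uw w0.
case: p => [|y p] in sp E.
  by exists ([:: x], ts); apply/and3P; split=> //=; rewrite -E.
have [ltxy|leyx] := ltnP x y.
  by exists ([:: x, y & p], ts); apply/and3P; split; rewrite //= ?ltxy // -E.
exists ([::], [:: x, y & p] :: ts); apply/and3P; split; rewrite /= -?E //.
have ltyx : y < x.
  by rewrite ltn_neqAle leyx andbT; apply: contraNneq xw => <-; rewrite -E inE eqxx.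
rewrite hts andbT /is_hook; move: xw uw w0.
rewrite -E mem_cat cat_uniq all_cat negb_or.
move=> /andP[xyp _] /and3P[uyp _ _] /andP[yp0 _].
by apply/and5P; split; rewrite //= ?xyp ?x0 //; rewrite /= in sp; rewrite sp orbT.
Qed.

Lemma hook_cons x t : is_hook (x :: t) ->
  exists y t', [/\ t = y :: t', y < x & sorted ltn t].
Proof.
case: t => [|y t] /and5P[_ _ // _ yx /= H]; exists y, t; split=> //.
by case: t H {yx}.
Qed.

Lemma hook_factorization_unique w f g :
  is_hook_factorization w f -> is_hook_factorization w g -> f = g.
Proof.
elim: w f g => [|x w IH].
  have nil h : is_hook_factorization [::] h -> h = ([::], [::]).
    by case: h => [[|a p] [|[|b t] ts]] //= /and3P[].
  by move=> f g /nil -> /nil ->.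
have step h : is_hook_factorization (x :: w) h ->
  exists t ts, is_hook_factorization w (t, ts) /\
    (h = (x :: t, ts) /\ (if t is y :: _ then x < y else true) \/
     h = ([::], (x :: t) :: ts) /\ (if t is y :: _ then y < x else false)).
  case: h => [[|a p] ts] /and3P[/= sp hts /eqP E].
    case: ts hts E => [|[|a t] ts] //= /andP[ht hts] [? E]; subst a.
    have [y [t' [tE yx st]]] := hook_cons ht.
    exists t, ts; split; first by apply/and3P; split=> //=; apply/eqP.
    by right; split=> //; rewrite tE.
  case: E => ? E; subst a; exists p, ts; split.
    by apply/and3P; split=> //=; [exact: path_sorted sp | apply/eqP].
  by left; split=> //; case: p sp {E} => //= y p /andP[].
move=> f g /step[t [ts [h1 H1]]] /step[t2 [ts2 [h2 H2]]].
have [? ?] := IH _ _ h1 h2; subst t2 ts2.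
case: H1 H2 => -[-> c1] [] [-> c2] //; case: t c1 c2 {h1 h2} => // y t c1 c2.
  by have := ltn_trans c1 c2; rewrite ltnn.
by have := ltn_trans c1 c2; rewrite ltnn.
Qed.

Section Permutations.
Variables (n : nat) (sigma : 'S_n).

(* The one-line notation of sigma, on the letters 1, ..., n. *)
Definition perm_word : seq nat := [seq (val (sigma i)).+1 | i <- enum 'I_n].

Lemma perm_word_uniq : uniq perm_word.
Proof.
rewrite map_inj_uniq ?enum_uniq // => i j [] /val_inj; exact: perm_inj.
Qed.

Lemma perm_word_gt0 : all (ltn 0) perm_word.
Proof. by rewrite all_map; apply/allP. Qed.

Definition hook_factorization : seq nat * seq (seq nat) :=
  xchoose (ex_hook_factorization perm_word_uniq perm_word_gt0).

Definition perm_inversions : nat := word_inv perm_word.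
Definition pix : nat := size hook_factorization.1.
Definition lec : nat := \sum_(tau <- hook_factorization.2) word_inv tau.

End Permutations.

Local Open Scope ring_scope.

Section Series.
Variable F : fieldType.

(* The formal power series \sum_n f_n u^n is the sequence f of coefficients. *)
Definition fps := nat -> F.

Definition fps_sub (f g : fps) : fps := fun n => f n - g n.
Definition fps_scale (c : F) (f : fps) : fps := fun n => c * f n.
Definition fps_mul (f g : fps) : fps :=
  fun n => \sum_(k < n.+1) f k * g (n - k)%N.

(* First n coefficients of the quotient f / g, meaningful when g 0 != 0. *)
Fixpoint fps_quot_seq (f g : fps) (n : nat) : seq F :=
  if n is m.+1 then
    let c := fps_quot_seq f g m in
    rcons c ((f m - \sum_(k < m) c`_k * g (m - k)%N) / g 0%N)
  else [::].

Definition fps_div (f g : fps) : fps := fun n => (fps_quot_seq f g n.+1)`_n.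

Lemma size_fps_quot_seq f g n : size (fps_quot_seq f g n) = n.
Proof. by elim: n => //= n IH; rewrite size_rcons IH. Qed.

Lemma nth_fps_quot_seq f g n k :
  (k < n)%N -> (fps_quot_seq f g n)`_k = fps_div f g k.
Proof.
elim: n => // n IH; rewrite ltnS leq_eqVlt => /orP[/eqP-> //|kn].
by rewrite /= nth_rcons size_fps_quot_seq kn IH.
Qed.

Lemma fps_divE f g n :
  fps_div f g n = (f n - \sum_(k < n) fps_div f g k * g (n - k)%N) / g 0%N.
Proof.
rewrite {1}/fps_div /= nth_rcons size_fps_quot_seq ltnn eqxx.
by congr ((_ - _) / _); apply: eq_bigr => k _; rewrite nth_fps_quot_seq.
Qed.

Lemma fps_divK f g : g 0%N != 0 -> fps_mul (fps_div f g) g =1 f.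
Proof.
move=> g0 n; rewrite /fps_mul big_ord_recr /= subnn [in X in _ + X]fps_divE.
by rewrite mulfVK // addrC subrK.
Qed.

Lemma fps_div_unique f g h :
  g 0%N != 0 -> fps_mul h g =1 f -> h =1 fps_div f g.
Proof.
move=> g0 E n; elim/ltn_ind: n => n IH.
rewrite fps_divE -E /fps_mul big_ord_recr /= subnn.
rewrite (eq_bigr (fun k : 'I_n => fps_div f g k * g (n - k)%N)); last first.
  by move=> k _; rewrite IH.
by rewrite addrC addrK mulfK.
Qed.

Definition qpoch (q : F) (n : nat) : F := \prod_(1 <= i < n.+1) (1 - q ^+ i).

(* The series e_q(c u) in the variable u. *)
Definition eq_series (q c : F) : fps := fun n => c ^+ n / qpoch q n.

Definition A_gf (s q Y : F) : fps :=
  fps_div (fps_scale (1 - s * q) (eq_series q Y))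
          (fps_sub (eq_series q (s * q)) (fps_scale (s * q) (eq_series q 1))).

Definition A (s q Y : F) (n : nat) : F := qpoch q n * A_gf s q Y n.

(* The equation defining the A_n, with the denominator cleared. *)
Lemma A_gfP (s q Y : F) : (forall n, qpoch q n != 0) -> 1 - s * q != 0 ->
  fps_mul (fun n => A s q Y n / qpoch q n)
      (fps_sub (eq_series q (s * q)) (fps_scale (s * q) (eq_series q 1)))
  =1 fps_scale (1 - s * q) (eq_series q Y).
Proof.
move=> q0 sq n; rewrite -[RHS](@fps_divK _ (fps_sub (eq_series q (s * q))
  (fps_scale (s * q) (eq_series q 1)))).
  by apply: eq_bigr => k _; rewrite /A [qpoch _ _ * _]mulrC mulfK.
by rewrite /fps_sub /fps_scale /eq_series /qpoch big_geq // !expr0 divr1 mulr1.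
Qed.

End Series.

Notation "x %:F" := (tofrac x) : ring_scope.

(* Polynomials in the indeterminates s, q, Y.  The quotient defining the A_n  *)
(* is taken over the fraction field, so A_n is a priori a rational function.  *)
Notation ZsqY := {mpoly int[3]}.
Definition s_ : ZsqY := 'X_(@Ordinal 3 0 isT).
Definition q_ : ZsqY := 'X_(@Ordinal 3 1 isT).
Definition Y_ : ZsqY := 'X_(@Ordinal 3 2 isT).

Lemma qpoch_neq0 (n : nat) : qpoch q_%:F n != 0.
Proof.
rewrite /qpoch big_nat prodf_seq_neq0; apply/allP => i _.
apply/implyP => /andP[i0 _]; rewrite -tofracXn -tofrac1 -tofracB tofrac_eq0.
apply/eqP => /(congr1 (meval (fun=> 0))) /eqP.
by rewrite mevalB rmorphXn /= meval1 meval0 mevalXU expr0n eqn0Ngt i0 subr0 oner_eq0.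
Qed.

Lemma one_sub_sq_neq0 : 1 - s_%:F * q_%:F != 0.
Proof.
rewrite -tofracM -tofrac1 -tofracB tofrac_eq0.
apply/eqP => /(congr1 (meval (fun=> 0))) /eqP.
by rewrite mevalB mevalM meval1 meval0 !mevalXU mul0r subr0 oner_eq0.
Qed.

(* Main.v *)
Require Import Defs.
From mathcomp Require Import all_boot all_order all_fingroup all_algebra.
From mathcomp.multinomials Require Import mpoly.
From mathcomp Require Import ring zify.

Set Implicit Arguments.
Unset Strict Implicit.
Unset Printing Implicit Defensive.

Import GRing.Theory.

(* Every unsorted word has a unique suffix that is a hook, namely the one that
   starts at its last descent, and removing it removes the last hook of the
   factorization.  Splitting permutations of n letters into a prefix of length
   k and a suffix contributes the Gaussian binomial [n choose k]_q, so the
   weighted sums B_n satisfy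
     B_n = Y^n + \sum_(k < n) [n choose k]_q B_k H_(n-k)
   where H_m is the sum over the hooks on m letters.  A word is a hook iff its
   tail is increasing but the word itself is not, which gives
   H_m = (1 - z^m) / (1 - z) - 1 for m >= 1 and z = s q.  Dividing by (q; q)_n
   turns the recurrence into the equation that defines the A_n. *)

(** * Inversions of words and invariance under relabelling *)

Fixpoint inversions (w : seq nat) : nat :=
  if w is x :: v then count (ltn^~ x) v + inversions v else 0.

Definition cross_inversions (u v : seq nat) : nat :=
  \sum_(x <- u) count (ltn^~ x) v.

Lemma word_invE (w : seq nat) : word_inv w = inversions w.
Proof.
have -> : word_inv w =
    \sum_(a < size w) \sum_(b < size w) ((a < b) && (nth 0 w b < nth 0 w a) : nat).
  rewrite /word_inv -sum1_card pair_big /= big_mkcond /=.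
  by apply: eq_bigr => -[a b] _; rewrite inE; case: ifP.
elim: w => [|x w IH]; first by rewrite big_ord0.
rewrite /= big_ord_recl big_ord_recl /= add0n -IH; congr (_ + _).
  by rewrite -sum1_count (big_nth 0) big_mkord [RHS]big_mkcond; apply: eq_bigr => i _; case: ifP.
by apply: eq_bigr => a _; rewrite big_ord_recl /= add0n.
Qed.

Lemma inversions_cat (u v : seq nat) :
  inversions (u ++ v) = inversions u + inversions v + cross_inversions u v.
Proof.
elim: u => [|x u IH]; first by rewrite /cross_inversions big_nil addn0.
by rewrite /= IH count_cat /cross_inversions big_cons /=; ring.
Qed.

Lemma inversions_sorted (w : seq nat) : sorted ltn w -> inversions w = 0.
Proof.
elim: w => //= x w IH xw; rewrite IH ?(path_sorted xw) // addn0.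
apply/eqP; rewrite -leqn0 leqNgt -has_count; apply/hasPn => y yw.
by rewrite -leqNgt ltnW // (allP (order_path_min ltn_trans xw)).
Qed.

Lemma cross_inversions_perm (u u' v v' : seq nat) : perm_eq u u' -> perm_eq v v' ->
  cross_inversions u v = cross_inversions u' v'.
Proof.
move=> /(perm_big _) uu /seq.permP vv; rewrite /cross_inversions uu.
by apply: eq_bigr => x _; exact: vv.
Qed.

(* [F] depends only on the relative order of the letters of its argument. *)
Definition order_invariant (T : Type) (F : seq nat -> T) : Prop :=
  forall (h : nat -> nat) (w : seq nat),
    {in w &, {mono h : x y / x < y}} -> F (map h w) = F w.

Lemma inversions_invariant : order_invariant inversions.
Proof.
move=> h; elim=> //= x w IH hw; rewrite IH; last first.
  by move=> a b aw bw; apply: hw; rewrite inE ?aw ?bw orbT.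
rewrite count_map; congr (_ + _); apply: eq_in_count => y yw /=.
by rewrite hw // inE ?eqxx ?yw ?orbT.
Qed.

Lemma sorted_invariant : order_invariant (sorted ltn).
Proof.
by move=> h w hw; apply: (mono_sorted_in (P := mem w)) => //; apply/allP.
Qed.

(** * The hook factorization, computed from right to left *)

Fixpoint hooks (w : seq nat) : seq nat * seq (seq nat) :=
  if w is x :: v then
    let: (p, ts) := hooks v in
    if p is y :: _ then
      if x < y then (x :: p, ts) else ([::], (x :: p) :: ts)
    else ([:: x], ts)
  else ([::], [::]).

(* Agrees with [is_hook] on words of distinct positive letters; dropping the
   other conditions makes it invariant under every order-preserving relabelling. *)
Definition hook (w : seq nat) : bool :=
  if w is x :: ((y :: _) as v) then (y < x) && sorted ltn v else false.

Lemma hooks_sorted (w : seq nat) : sorted ltn w -> hooks w = (w, [::]).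
Proof.
elim: w => //= x w IH xw; rewrite IH ?(path_sorted xw) //.
by case: w xw {IH} => //= y w /andP[->].
Qed.

(** Read from the right, [t] builds up an increasing run that its first letter closes into a hook.
    The pending prefix is then empty, so [v] is processed as if nothing followed it. *)
Lemma hooks_cat_hook (v t : seq nat) : hook t ->
  hooks (v ++ t) = ((hooks v).1, rcons (hooks v).2 t).
Proof.
move=> ht; elim: v => [|x v /= ->].
  case: t ht => [|x [|y t]] // /andP[yx yt].
  (* [hooks] is unfolded once only, which keeps [hooks (y :: t)] in the form that [hooks_sorted]
     rewrites. *)
  rewrite cat0s -[hooks _]/(let: (p, ts) := hooks (y :: t) in
    if p is y :: _ then
      if x < y then (x :: p, ts) else ([::], (x :: p) :: ts)
    else ([:: x], ts)) hooks_sorted //.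
  by rewrite ltnNge ltnW.
by case: (hooks v) => -[|y p] ts //=; case: ifP.
Qed.

Lemma sorted_or_hook (w : seq nat) : uniq w ->
  sorted ltn w \/ exists2 k, k < size w & hook (drop k w).
Proof.
elim: w => [|x w IH] /=; first by left.
case/andP=> xw /IH [sw|[k kw hk]]; last by right; exists k.+1.
case: w sw xw {IH} => [|y w] sw; first by left.
rewrite inE negb_or; case: (ltngtP x y) => //= [xy|yx] _; first by left; rewrite xy.
by right; exists 0 => //; rewrite drop0 /= yx.
Qed.

(** Both suffixes are the last entry of [(hooks w).2], hence they have the same length. *)
Lemma hook_drop_unique (w : seq nat) (k l : nat) : k <= size w -> l <= size w ->
  hook (drop k w) -> hook (drop l w) -> k = l.
Proof.
move=> kw lw hk hl.
have := hooks_cat_hook (take k w) hk; rewrite cat_take_drop.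
rewrite -{1}(cat_take_drop l w) (hooks_cat_hook _ hl) => -[_ /rcons_inj[_]].
by move/(congr1 size); rewrite !size_drop; lia.
Qed.

Lemma hook_drop_unsorted (w : seq nat) (k : nat) : hook (drop k w) -> ~~ sorted ltn w.
Proof.
move=> hk; apply/negP => /(drop_sorted k); case: (drop k w) hk => [|x [|y v]] //=.
by case/andP => yx _ /andP[xy _]; have := ltn_trans yx xy; rewrite ltnn.
Qed.

Lemma hooks_cat_flatten (w : seq nat) : (hooks w).1 ++ flatten (hooks w).2 = w.
Proof.
elim: w => //= x w; case: (hooks w) => -[|y p] ts /= <- //.
by case: ifP.
Qed.

Lemma hooks_map (h : nat -> nat) (w : seq nat) : {in w &, {mono h : x y / x < y}} ->
  hooks (map h w) = (map h (hooks w).1, map (map h) (hooks w).2).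
Proof.
elim: w => //= x w IH hw; rewrite IH; last first.
  by move=> a b aw bw; apply: hw; rewrite inE ?aw ?bw orbT.
have := hooks_cat_flatten w; case: (hooks w) => -[|y p] ts //= E.
by rewrite hw ?inE ?eqxx // -?E ?inE ?eqxx ?orbT //; case: ifP.
Qed.

Lemma hook_is_hook (w : seq nat) : uniq w -> all (ltn 0) w -> hook w -> is_hook w.
Proof.
case: w => [|x [|y w]] // u p /andP[yx s].
by rewrite /is_hook u p /= yx /=; rewrite /= in s; rewrite s orbT.
Qed.

Lemma hooks_parts (w : seq nat) : uniq w ->
  sorted ltn (hooks w).1 && all hook (hooks w).2.
Proof.
elim: w => //= x w IH /andP[xw uw]; have := IH uw; have := hooks_cat_flatten w.
case: (hooks w) => -[|y p] ts E /andP[/= sp hs] //=.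
have xy : x != y by apply: contraNneq xw => ->; rewrite -E /= inE eqxx.
by case: ltngtP xy => //= yx _; rewrite ?sp ?yx.
Qed.

Lemma hooks_factorization (w : seq nat) : uniq w -> all (ltn 0) w ->
  is_hook_factorization w (hooks w).
Proof.
move=> uw pw; rewrite /is_hook_factorization hooks_cat_flatten eqxx andbT.
have /andP[-> hs] /= := hooks_parts uw; apply/allP => t tw.
apply: hook_is_hook; last exact: (allP hs).
  move: uw; rewrite -{1}(hooks_cat_flatten w) cat_uniq => /and3P[_ _].
  by case/splitPr: tw => a b; rewrite flatten_cat /= !cat_uniq => /and3P[_ _ /and3P[]].
apply/allP => x xt; apply: (allP pw); rewrite -(hooks_cat_flatten w) mem_cat; apply/orP; right.
by apply/flattenP; exists t.
Qed.

Lemma hook_factorizationE (n : nat) (sigma : 'S_n) :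
  hook_factorization sigma = hooks (perm_word sigma).
Proof.
apply: (@hook_factorization_unique (perm_word sigma)); first exact: xchooseP.
exact: hooks_factorization (perm_word_uniq sigma) (perm_word_gt0 sigma).
Qed.

(** Injectivity of the one-line notation and the common cardinality n! reduce this to one inclusion,
    and that in turn to n distinct letters among 1, ..., n. *)
Lemma perm_word_permutations (n : nat) :
  perm_eq [seq perm_word sigma | sigma <- index_enum 'S_n] (permutations (iota 1 n)).
Proof.
have inj : injective (@perm_word n).
  move=> s t /eq_in_map E; apply/permP => i.
  by have /(_ (mem_enum _ i))[/val_inj] := E i.
have um : uniq [seq perm_word sigma | sigma <- index_enum 'S_n].
  by rewrite map_inj_uniq // index_enum_uniq.
have sz : size (permutations (iota 1 n)) <= size [seq perm_word sigma | sigma <- index_enum 'S_n].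
  rewrite size_permutations ?iota_uniq // size_iota size_map -card_Sn.
  by rewrite cardT enumT [index_enum _]unlock.
apply: uniq_perm => //; first exact: permutations_uniq.
apply: (uniq_min_size um _ sz).2 => w /mapP[s _ ->].
rewrite mem_permutations; apply: uniq_perm (perm_word_uniq s) (iota_uniq _ _) _.
apply: (uniq_min_size (perm_word_uniq s) _ _).2.
  by move=> x /mapP[i _ ->]; rewrite mem_iota add1n ltnS; exact: ltn_ord.
by rewrite size_iota size_map size_enum_ord.
Qed.

(** * Cutting permutations into a prefix and a suffix *)

Local Open Scope ring_scope.

(* The pairs formed by a subsequence of length [k] of [s] and its complement. *)
Fixpoint splits (T : Type) (k : nat) (s : seq T) : seq (seq T * seq T) :=
  if s is x :: s' then
    (if k is k'.+1 then [seq (x :: p.1, p.2) | p <- splits k' s'] else [::])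
    ++ [seq (p.1, x :: p.2) | p <- splits k s']
  else if k is 0 then [:: ([::], [::])] else [::].

Lemma mem_splits (T : eqType) (s : seq T) (k : nat) (p : seq T * seq T) :
  p \in splits k s ->
  [/\ size p.1 = k, perm_eq (p.1 ++ p.2) s, subseq p.1 s & subseq p.2 s].
Proof.
elim: s k p => [|x s IH] k p /=; first by case: k => //; rewrite inE => /eqP->.
rewrite mem_cat => /orP[|/mapP[r /IH[sz pe s1 s2] ->]].
  case: k => // k /mapP[r /IH[sz pe s1 s2] ->].
  split; rewrite /= ?sz ?perm_cons ?eqxx //.
  exact: subseq_trans s2 (subseq_cons s x).
split; rewrite /= ?eqxx //; last exact: subseq_trans s1 (subseq_cons s x).
by rewrite -cat1s perm_catCA /= perm_cons.
Qed.

Lemma filter_splits (T : eqType) (s : seq T) (a : pred T) :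
  (filter a s, filter (predC a) s) \in splits (count a s) s.
Proof.
elim: s => //= x s IH; case: (a x) => /=; rewrite mem_cat; apply/orP.
  by left; apply/mapP; eexists; first exact: IH.
by right; apply/mapP; eexists; first exact: IH.
Qed.

Lemma splits_uniq (T : eqType) (s : seq T) (k : nat) : uniq s -> uniq (splits k s).
Proof.
elim: s k => [|x s IH] [|k] //= /andP[xs us].
  by rewrite map_inj_uniq ?IH // => -[a b] [c d] [-> ->].
rewrite cat_uniq !map_inj_uniq ?IH //; first last.
- by move=> [a b] [c d] [-> ->].
- by move=> [a b] [c d] [-> ->].
rewrite andbT /=; apply/hasPn => p /mapP[r /mem_splits[_ _ s1 _] ->] /=.
apply: contra xs => /mapP[t _ [E _]].
by apply: (mem_subseq s1); rewrite E mem_head.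
Qed.

Lemma permutations_splits (s : seq nat) (k : nat) : sorted ltn s -> (k <= size s)%N ->
  perm_eq (permutations s)
    [seq uv.1 ++ uv.2 | p <- splits k s,
       uv <- [seq (u, v) | u <- permutations p.1, v <- permutations p.2]].
Proof.
move=> ss ks; have us : uniq s := sorted_uniq ltn_trans ltnn ss.
have sub_sorted u : subseq u s -> sorted ltn u.
  by move=> us'; exact: (subseq_sorted ltn_trans us' ss).
apply: uniq_perm; first exact: permutations_uniq.
  apply: allpairs_uniq_dep; first exact: splits_uniq.
    move=> p _; apply: allpairs_uniq; rewrite ?permutations_uniq //.
    by move=> -[a b] [c d] _ _ /= [-> ->].
  move=> z z' /allpairsPdep[p [[u v] [xs yp ->]]] /allpairsPdep[p' [[u' v'] [xs' yp' ->]]].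
  move: yp yp' => /allpairsP[[a b] /= [ap bp [? ?]]] /allpairsP[[a' b'] /= [ap' bp' [? ?]]].
  subst a b a' b'; rewrite !mem_permutations in ap bp ap' bp'.
  have [sz pe s1 s2] := mem_splits xs; have [sz' pe' s1' s2'] := mem_splits xs'.
  (* Both prefixes have length [k], so equal words have equal halves; the letters of a half
     determine the increasing subsequence that it rearranges. *)
  move=> /= /eqP; rewrite eqseq_cat ?(perm_size ap) ?(perm_size ap') ?sz ?sz' //.
  move=> /andP[/eqP ? /eqP ?].
  subst u' v'; suff -> : p = p' by [].
  case: p p' {xs xs' pe pe' sz sz'} ap bp ap' bp' s1 s2 s1' s2' =>
    [p1 p2] [p1' p2'] /= ap bp ap' bp' s1 s2 s1' s2'.
  congr (_, _); apply: (irr_sorted_eq ltn_trans ltnn); rewrite ?sub_sorted // => x.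
    by rewrite -(perm_mem ap) (perm_mem ap').
  by rewrite -(perm_mem bp) (perm_mem bp').
move=> w; rewrite mem_permutations; apply/idP/allpairsPdep.
  move=> ws; have uw : uniq w by rewrite (perm_uniq ws).
  move: (uw); rewrite -{1}(cat_take_drop k w) cat_uniq => /and3P[ut dtd ud].
  (* The split is read off [w]: the letters of its first [k] positions, and the rest, each listed in
     the order of [s]. *)
  exists (filter (mem (take k w)) s, filter (predC (mem (take k w))) s), (take k w, drop k w).
  have e1 : perm_eq (take k w) (filter (mem (take k w)) s).
    apply: uniq_perm; rewrite ?filter_uniq // => x; rewrite mem_filter /= -(perm_mem ws).
    by case: (boolP (x \in take k w)) => // /mem_take ->.
  have e2 : perm_eq (drop k w) (filter (predC (mem (take k w))) s).
    apply: uniq_perm; rewrite ?filter_uniq // => x; rewrite mem_filter /= -(perm_mem ws).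
    have -> : (x \in w) = (x \in take k w) || (x \in drop k w) by rewrite -mem_cat cat_take_drop.
    case: (boolP (x \in drop k w)) => [xd|_]; last by rewrite orbF andNb.
    by rewrite orbT andbT (hasPn dtd).
  split; last by rewrite cat_take_drop.
    rewrite -[X in splits X _](_ : count (mem (take k w)) s = k) ?filter_splits //.
    by rewrite -size_filter -(perm_size e1) size_takel // (perm_size ws).
  by apply/allpairsP; exists (take k w, drop k w); rewrite !mem_permutations.
case=> -[p1 p2] [y [/mem_splits[_ pe _ _] /allpairsP[[u v] /= [+ + ->]] ->]] /=.
rewrite !mem_permutations => up vp; apply: perm_trans pe.
by rewrite perm_cat.
Qed.

(** * Gaussian binomials and q-weighted sums over permutations *)

Section InversionSums.
Variable K : fieldType.
Implicit Types (q s Y : K) (F G : seq nat -> K).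

Definition inv_sum q F (l : seq nat) : K :=
  \sum_(w <- permutations l) q ^+ inversions w * F w.

(** Defining the Gaussian binomial by the q-Pascal rule avoids division, so it makes sense even
    where (q; q)_n vanishes. *)
Fixpoint gauss q (n k : nat) : K :=
  match n, k with
  | _, 0 => 1
  | 0, _.+1 => 0
  | n'.+1, k'.+1 => gauss q n' k' + q ^+ k * gauss q n' k
  end.

Lemma gauss0 q n : gauss q n 0 = 1.
Proof. by case: n. Qed.

Lemma gauss_small q n k : (n < k)%N -> gauss q n k = 0.
Proof.
elim: n k => [|n IH] [|k] //= nk; rewrite !IH ?mulr0 ?addr0 //.
exact: ltnW.
Qed.

Lemma qpochS q n : qpoch q n.+1 = qpoch q n * (1 - q ^+ n.+1).
Proof. by rewrite /qpoch big_nat_recr. Qed.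

Lemma qpoch0 q : qpoch q 0 = 1.
Proof. by rewrite /qpoch big_geq. Qed.

Lemma gauss_qpoch q k m : gauss q (k + m) k * (qpoch q k * qpoch q m) = qpoch q (k + m).
Proof.
move En: (k + m)%N => n; elim: n k m En => [|n IH] [|k] m //= E.
- have -> : m = 0%N by lia.
  by rewrite qpoch0 !mul1r.
- have -> : m = n.+1 by lia.
  by rewrite qpoch0 !mul1r.
(* For m = 0 the second Pascal term is [gauss q n n.+1], which is zero. *)
case: m E => [|m] E.
  have Ek : k = n by lia.
  have := IH k 0%N ltac:(lia); rewrite Ek (gauss_small q (ltnSn n)) qpoch0 !mulr1.
  rewrite mulr0 addr0 qpochS.
  by rewrite mulrA => ->.
have E1 := IH k m.+1 ltac:(lia); have E2 := IH k.+1 m ltac:(lia).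
rewrite [RHS]qpochS.
(* The two Pascal terms combine through 1 - q^(n+1) = (1 - q^(k+1)) + q^(k+1) (1 - q^(m+1)). *)
transitivity (gauss q n k * (qpoch q k * qpoch q m.+1) * (1 - q ^+ k.+1) +
   q ^+ k.+1 * (1 - q ^+ m.+1) * (gauss q n k.+1 * (qpoch q k.+1 * qpoch q m))).
  by rewrite !(qpochS _ k) !(qpochS _ m); ring.
rewrite E1 E2; have -> : q ^+ n.+1 = q ^+ k.+1 * q ^+ m.+1 by rewrite -exprD; congr (_ ^+ _); lia.
ring.
Qed.

(** This is the q-Pascal rule: the smallest letter either joins the left part and creates no cross
    inversion, or joins the right part and is inverted with all [k] letters on the left. *)
Lemma sum_splits_gauss q (l : seq nat) k : sorted ltn l ->
  \sum_(p <- splits k l) q ^+ cross_inversions p.1 p.2 = gauss q (size l) k.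
Proof.
have cons0 (x : nat) (l' : seq nat) (p : seq nat * seq nat) j :
    path ltn x l' -> p \in splits j l' ->
    (all (ltn x) p.1 /\ all (ltn x) p.2) /\ size p.1 = j.
  move=> xl /mem_splits[sz _ s1 s2]; have al := order_path_min ltn_trans xl.
  by split=> //; split; apply/allP => y yp; apply: (allP al);
    [apply: (mem_subseq s1)|apply: (mem_subseq s2)].
have c0 x v : all (ltn x) v -> count (ltn^~ x) v = 0%N.
  move=> xv; apply/eqP; rewrite -leqn0 leqNgt -has_count; apply/hasPn => y yv.
  by rewrite -leqNgt; apply: ltnW; exact: (allP xv).
elim: l k => [|x l IH] k xl.
  case: k => [|k] /=; last by rewrite big_nil.
  by rewrite big_seq1 /cross_inversions big_nil.
have sl := path_sorted xl; rewrite /= big_cat /= !big_map.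
have right : \sum_(p <- splits k l) q ^+ cross_inversions p.1 (x :: p.2) =
    q ^+ k * gauss q (size l) k.
  rewrite -IH // big_distrr /= !big_seq; apply: eq_bigr => p pl.
  have [[x1 x2] sz] := cons0 _ _ _ _ xl pl; rewrite -exprD; congr (_ ^+ _).
  rewrite /cross_inversions /= big_split /=; congr (_ + _)%N.
  rewrite -sz -sum1_size !big_seq; apply: eq_bigr => y yp.
  by have /= -> := allP x1 _ yp.
rewrite right; case: k right => [|k] _; first by rewrite big_nil gauss0 add0r mul1r.
rewrite big_map; congr (_ + _); rewrite -IH // !big_seq; apply: eq_bigr => p pl.
have [[x1 x2] _] := cons0 _ _ _ _ xl pl.
by rewrite /cross_inversions /= big_cons c0.
Qed.

(** The increasing map [h] sending i to the i-th letter of [l] changes neither [inversions] nor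
    [F]. *)
Lemma inv_sum_relabel q F (l : seq nat) : order_invariant F -> sorted ltn l ->
  inv_sum q F l = inv_sum q F (iota 0 (size l)).
Proof.
move=> iF sl; pose h i := nth 0%N l i.
have ul : uniq l := sorted_uniq ltn_trans ltnn sl.
have hm : {in iota 0 (size l) &, {mono h : x y / (x < y)%N}}.
  move=> x y; rewrite !mem_iota /= !add0n => xl yl.
  have H := sorted_ltn_nth ltn_trans 0%N sl.
  by case: (ltngtP x y) => [/H->|/H yx|->]; rewrite ?ltnn // ltnNge ltnW ?yx.
have hi : {in iota 0 (size l) &, injective h}.
  by move=> x y; rewrite !mem_iota /= !add0n => xl yl /eqP; rewrite nth_uniq // => /eqP.
have hl : map h (iota 0 (size l)) = l by rewrite map_nth_iota0 ?take_size.
have pm : perm_eq (permutations l) (map (map h) (permutations (iota 0 (size l)))).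
  have um : uniq (map (map h) (permutations (iota 0 (size l)))).
    rewrite map_inj_in_uniq ?permutations_uniq // => u v.
    rewrite !mem_permutations => up vp E.
    apply: (inj_in_map hi) E; apply/allP => x.
      by rewrite (perm_mem up).
    by rewrite (perm_mem vp).
  rewrite perm_sym; apply: uniq_perm => //; first exact: permutations_uniq.
  apply: (uniq_min_size um _ _).2.
    by move=> w /mapP[u + ->]; rewrite !mem_permutations -{2}hl; exact: perm_map.
  by rewrite size_map !size_permutations ?iota_uniq // size_iota.
rewrite /inv_sum (perm_big _ pm) big_map !big_seq; apply: eq_bigr => w.
rewrite mem_permutations => wp; have hw : {in w &, {mono h : x y / (x < y)%N}}.
  by move=> x y xw yw; apply: hm; rewrite -(perm_mem wp).
by rewrite inversions_invariant // iF.
Qed.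

(** For a fixed split of the letters the cross inversions are constant, and by relabelling the sums
    over the two halves depend only on their lengths. What remains is the sum of q^cross over the
    splits. *)
Lemma inv_sum_cat q F G n k : (k <= n)%N -> order_invariant F -> order_invariant G ->
  inv_sum q (fun w => F (take k w) * G (drop k w)) (iota 0 n) =
  gauss q n k * inv_sum q F (iota 0 k) * inv_sum q G (iota 0 (n - k)).
Proof.
move=> kn iF iG; have sl : sorted ltn (iota 0 n) := iota_ltn_sorted 0 n.
have sz : size (iota 0 n) = n := size_iota 0 n.
have pk := permutations_splits sl; rewrite sz in pk.
rewrite [LHS]/inv_sum (perm_big _ (pk k kn)) big_allpairs_dep.
rewrite -[n in gauss q n k]sz -sum_splits_gauss // !big_distrl /= !big_seq.
apply: eq_bigr => p /mem_splits[sp pe s1 s2].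
have sp2 : size p.2 = (n - k)%N.
  by have := perm_size pe; rewrite size_cat sz sp => <-; rewrite addKn.
have <- : inv_sum q F p.1 = inv_sum q F (iota 0 k).
  by rewrite inv_sum_relabel ?sp // (subseq_sorted ltn_trans s1).
have <- : inv_sum q G p.2 = inv_sum q G (iota 0 (n - k)).
  by rewrite inv_sum_relabel ?sp2 // (subseq_sorted ltn_trans s2).
rewrite /inv_sum big_allpairs_dep /= -[RHS]mulrA mulr_suml mulr_sumr !big_seq; apply: eq_bigr => u.
rewrite mem_permutations => up; rewrite !mulr_sumr !big_seq; apply: eq_bigr => v.
rewrite mem_permutations => vp.
have su : size u = k by rewrite (perm_size up).
rewrite -su take_size_cat // drop_size_cat // inversions_cat !exprD.
rewrite (cross_inversions_perm up vp); ring.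
Qed.

Lemma inv_sum_sorted q n : inv_sum q (fun w => (sorted ltn w)%:R) (iota 0 n) = 1.
Proof.
have im : iota 0 n \in permutations (iota 0 n) by rewrite mem_permutations.
rewrite /inv_sum (bigD1_seq _ im (permutations_uniq _)) /=.
rewrite iota_ltn_sorted inversions_sorted ?iota_ltn_sorted // mulr1 expr0.
rewrite big_seq_cond big1 ?addr0 // => w /andP[].
rewrite mem_permutations => wp; case sw: (sorted ltn w); last by rewrite mulr0.
case/eqP; apply: (irr_sorted_eq ltn_trans ltnn); rewrite ?iota_ltn_sorted //.
exact: perm_mem.
Qed.

Lemma gauss1 q n : (1 - q) * gauss q n 1 = 1 - q ^+ n.
Proof.
elim: n => [|n IH] /=; first by rewrite expr0; ring.
by rewrite gauss0 mulrDr mulrCA IH !exprS expr0; ring.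
Qed.

Lemma hook_indicator w : uniq w -> w != [::] ->
  (hook w)%:R = (sorted ltn (drop 1 w))%:R - (sorted ltn w)%:R :> K.
Proof.
case: w => [|x [|y w]] // /andP[+ _] _; first by rewrite /= subrr.
rewrite drop1 inE negb_or => /andP[xy _] /=.
by case: ltngtP xy => //= _ _; rewrite ?subrr ?subr0.
Qed.

(** The right-hand side is minus the coefficient of u^n / (q; q)_n in the denominator e_q(squ) - sq
    e_q(u). *)
Lemma inv_sum_hook q s n : (0 < n)%N ->
  (1 - s * q) * inv_sum q (fun w => (hook w)%:R * s ^+ inversions w) (iota 0 n)
  = s * q - (s * q) ^+ n.
Proof.
move=> n0; set z := s * q.
have sI : order_invariant (fun w => (sorted ltn w)%:R : K).
  by move=> h w hw; rewrite sorted_invariant.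
(* On hooks the weight q^inv s^inv is z^inv, so z takes over the role of q. *)
have -> : inv_sum q (fun w => (hook w)%:R * s ^+ inversions w) (iota 0 n) =
    inv_sum z (fun w => 1 * (sorted ltn (drop 1 w))%:R) (iota 0 n) -
    inv_sum z (fun w => (sorted ltn w)%:R) (iota 0 n).
  rewrite /inv_sum -sumrB !big_seq; apply: eq_bigr => w; rewrite mem_permutations => wp.
  rewrite hook_indicator; first by rewrite /z exprMn; ring.
    by rewrite (perm_uniq wp) iota_uniq.
  by rewrite -size_eq0 (perm_size wp) size_iota -lt0n.
(* Cutting after the first letter leaves the factor [gauss z n 1], which is 1 + z + ... +
   z^(n-1). *)
rewrite (@inv_sum_cat _ (fun=> 1) (fun w => (sorted ltn w)%:R)) // !inv_sum_sorted.
have -> : inv_sum z (fun=> 1) (iota 0 1) = 1.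
  by rewrite /inv_sum /= [permutations _]/= big_seq1 expr0 mulr1.
by rewrite !mulr1 mulrBr gauss1 mulr1; ring.
Qed.

(** * The recurrence and the generating function *)

Definition hook_weight s Y (w : seq nat) : K :=
  s ^+ (\sum_(t <- (hooks w).2) inversions t) * Y ^+ size (hooks w).1.

Lemma hook_weight_invariant s Y : order_invariant (hook_weight s Y).
Proof.
move=> h w hw; rewrite /hook_weight hooks_map // size_map big_map; congr (_ ^+ _ * _).
rewrite !big_seq; apply: eq_bigr => t tw; apply: inversions_invariant => x y xt yt.
have tsub : {subset t <= w}.
  move=> a at'; rewrite -(hooks_cat_flatten w) mem_cat; apply/orP; right.
  by apply/flattenP; exists t.
by apply: hw; apply: tsub.
Qed.

(** Exactly one indicator on the right is nonzero: that of [sorted] if [w] is increasing, otherwise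
    that of the unique hook suffix, whose removal divides the weight by s^inv. *)
Lemma hook_weight_rec s Y w : uniq w ->
  hook_weight s Y w = Y ^+ size w * (sorted ltn w)%:R +
    \sum_(k < size w) hook_weight s Y (take k w) *
       ((hook (drop k w))%:R * s ^+ inversions (drop k w)).
Proof.
move=> uw; case: (boolP (sorted ltn w)) => sw.
  rewrite big1 ?addr0 => [|k _].
    by rewrite /hook_weight hooks_sorted // big_nil mul1r mulr1.
  by case hk: (hook _); rewrite ?mul0r ?mulr0 //; have := hook_drop_unsorted hk; rewrite sw.
case: (sorted_or_hook uw) => [|[k kw hk]]; first by rewrite (negPf sw).
rewrite mulr0 add0r (bigD1 (Ordinal kw)) //= hk mul1r big1 ?addr0.
  rewrite /hook_weight -{1 2}(cat_take_drop k w) hooks_cat_hook //=.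
  by rewrite -cats1 big_cat big_seq1 /= exprD mulrAC.
move=> l lk; case hl: (hook _); rewrite ?mul0r ?mulr0 //.
case/eqP: lk; apply: val_inj => /=.
by apply: hook_drop_unique hl hk; apply: ltnW.
Qed.

Lemma inv_sum_hook_weight q s Y n :
  inv_sum q (hook_weight s Y) (iota 0 n) = Y ^+ n +
    \sum_(k < n) gauss q n k * inv_sum q (hook_weight s Y) (iota 0 k) *
      inv_sum q (fun w => (hook w)%:R * s ^+ inversions w) (iota 0 (n - k)).
Proof.
have hI : order_invariant (fun w => (hook w)%:R * s ^+ inversions w : K).
  move=> h w hw; rewrite inversions_invariant //; congr (_%:R * _).
  case: w hw => [|x [|y w]] //= hw; rewrite hw ?inE ?eqxx ?orbT //.
  congr (nat_of_bool (_ && _)); apply: (@sorted_invariant h (y :: w)) => a b aw bw.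
  by apply: hw; rewrite inE ?aw ?bw orbT.
rewrite (eq_bigr (fun k : 'I_n => inv_sum q (fun w => hook_weight s Y (take k w) *
    ((hook (drop k w))%:R * s ^+ inversions (drop k w))) (iota 0 n))); last first.
  move=> k _; rewrite (inv_sum_cat q (ltnW (ltn_ord k)) _ hI) //.
  exact: hook_weight_invariant.
(* Writing Y^n as a sum over the same permutations lets the identity be checked word by word. *)
rewrite -[X in X + _]mulr1 -[X in _ ^+ n * X + _](inv_sum_sorted q n) /inv_sum.
rewrite big_distrr exchange_big -big_split /= !big_seq.
apply: eq_bigr => w; rewrite mem_permutations => wp.
have sw : size w = n by rewrite (perm_size wp) size_iota.
rewrite hook_weight_rec ?(perm_uniq wp) ?iota_uniq // sw mulrDr big_distrr /=; congr (_ + _).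
by rewrite mulrCA.
Qed.

(** The series with coefficients B_m / (q; q)_m solves the equation of [A_gfP], and the solution is
    unique because [D] has constant term 1 - sq, which is nonzero. *)
Lemma A_inv_sum q s Y n : (forall m, qpoch q m != 0) -> 1 - s * q != 0 ->
  A s q Y n = inv_sum q (hook_weight s Y) (iota 0 n).
Proof.
move=> q0 z0; set B := fun m => inv_sum q (hook_weight s Y) (iota 0 m).
pose D := fps_sub (eq_series q (s * q)) (fps_scale (s * q) (eq_series q 1)).
have D0 : D 0%N = 1 - s * q.
  by rewrite /D /fps_sub /fps_scale /eq_series qpoch0 !expr0 divr1 mulr1.
have E : fps_mul (fun m => B m / qpoch q m) D =1 fps_scale (1 - s * q) (eq_series q Y).
  (* The term k = m is (1 - sq) B_m / (q; q)_m. Expanding B_m by the recurrence yields the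
     right-hand side plus a sum that cancels the terms k < m one by one. *)
  move=> m; rewrite /fps_mul big_ord_recr /= subnn D0.
  rewrite {2}/B inv_sum_hook_weight.
  rewrite /fps_scale /eq_series mulrDl mulrDl [X in _ + X]addrC addrA.
  rewrite [X in _ + X](_ : _ = (1 - s * q) * (Y ^+ m / qpoch q m)); last by rewrite mulrC.
  rewrite -[RHS]add0r; congr (_ + _); rewrite !big_distrl -big_split big1 //= => k _.
  have mk : (0 < m - k)%N by rewrite subn_gt0.
  have := inv_sum_hook q s mk; rewrite -/(B k).
  set H := inv_sum _ _ _ => EH.
  have km : (k + (m - k) = m)%N by rewrite subnKC // ltnW.
  have := gauss_qpoch q k (m - k); rewrite km => EG.
  have -> : D (m - k)%N = - ((1 - s * q) * H) / qpoch q (m - k).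
    by rewrite EH /D /fps_sub /fps_scale /eq_series expr1n; field; exact: q0.
  rewrite -EG; have g0 : gauss q m k != 0.
    by apply: contraNneq (q0 m) => g0; rewrite -EG g0 mul0r.
  by field; rewrite g0 !q0.
rewrite /A /A_gf -(fps_div_unique _ E) ?D0 //.
by rewrite mulrC divfK.
Qed.

End InversionSums.

Theorem theorem1p4 (n : nat) :
  (\sum_(sigma : 'S_n)
      s_ ^+ lec sigma * q_ ^+ perm_inversions sigma * Y_ ^+ pix sigma)%:F
  = A s_%:F q_%:F Y_%:F n.
Proof.
rewrite A_inv_sum; [|exact: qpoch_neq0|exact: one_sub_sq_neq0].
(* Relabelling passes from the letters 0, ..., n-1 to the letters 1, ..., n used by [perm_word]. *)
have := inv_sum_relabel q_%:F (@hook_weight_invariant _ s_%:F Y_%:F) (iota_ltn_sorted 1 n).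
rewrite size_iota => <-; rewrite /inv_sum -(perm_big _ (perm_word_permutations n)) /= big_map.
rewrite rmorph_sum /=; apply: eq_bigr => sigma _.
rewrite !rmorphM !rmorphXn /= /lec /pix /perm_inversions /hook_weight hook_factorizationE word_invE.
rewrite mulrCA mulrA; congr (_ ^+ _ * _ * _).
by apply: eq_bigr => t _; rewrite word_invE.
Qed.
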